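(* Let $\mathcal A$ be a semiring system and let $\mathcal P$ be an $\mathcal A$-systemic module. (1) The following are equivalent: (i) $\mathcal P$ is $(\preceq,h)$-projective. (ii) Every $\preceq$-onto homomorphism to $\mathcal P$ $\preceq$-splits. (iii) There is a $\preceq$-onto homomorphism from a free system to $\mathcal P$ that $\preceq$-splits. (iv) Given a $\preceq$-onto homomorphism $h:\mathcal M\to\mathcal M'$ of $\mathcal A$-systemic modules, the map $\mathrm{Mor}_\preceq(\mathcal P,h):\mathrm{Mor}_\preceq(\mathcal P,\mathcal M)\to\mathrm{Mor}_\preceq(\mathcal P,\mathcal M')$ given by $g\mapsto hg$ is $\preceq$-onto. (2) (h-version) The following are equivalent: (i) $\mathcal P$ is h-projective. (ii) Every $\preceq$-onto homomorphism to $\mathcal P$ h-splits. (iii) There is a $\preceq$-onto homomorphism from a free system to $\mathcal P$ that h-splits. (iv) Given a $\preceq$-onto homomorphism $h:\mathcal M\to\mathcal M'$ of $\mathcal A$-systemic modules, the map $\mathrm{Hom}(\mathcal P,h):\mathrm{Hom}(\mathcal P,\mathcal M)\to\mathrm{Hom}(\mathcal P,\mathcal M')$ given by $g\mapsto hg$ is $\preceq$-onto.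
   Context: Base definitions. Let $\mathcal T$ be a set. A $\mathcal T$-module is a commutative monoid $(\mathcal A,+,0)$ with a scalar multiplication $\mathcal T\times\mathcal A\to\mathcal A$ satisfying $a(\sum_j b_j)=\sum_j ab_j$ (finite sums) and $a0=0$. A negation map on it is a monoid isomorphism $(-):\mathcal A\to\mathcal A$ of order $\le 2$ with $(-)(ab)=a((-)b)$ for $a\in\mathcal T$, $b\in\mathcal A$. Write $b(-)c:=b+((-)c)$, $b^\circ:=b(-)b$, $\mathcal A^\circ:=\{b^\circ:b\in\mathcal A\}$. A pseudo-triple $(\mathcal A,\mathcal T_{\mathcal A},(-))$ is a $\mathcal T$-module with a negation map and a distinguished subset $\mathcal T_{\mathcal A}\subseteq\mathcal A$ (the tangible elements) with $(-)\mathcal T_{\mathcal A}=\mathcal T_{\mathcal A}$; it is a triple if moreover $\mathcal T_{\mathcal A}\cap\mathcal A^\circ=\emptyset$ and $\mathcal T_{\mathcal A}\cup\{0\}$ generates $(\mathcal A,+)$. A surpassing relation $\preceq$ is a pre-order on $\mathcal A$ such that: (i) $c^\circ\succeq 0$ for all $c$; (ii) $b_1\preceq b_2$ implies $(-)b_1\preceq(-)b_2$; (iii) $b_1\preceq b_2$ and $b_1'\preceq b_2'$ imply $b_1+b_1'\preceq b_2+b_2'$; (iv) $a\in\mathcal T$ and $b_1\preceq b_2$ imply $ab_1\preceq ab_2$; (v) $a\preceq b$ with $a,b\in\mathcal T_{\mathcal A}$ implies $a=b$. A system (resp. pseudo-system) $(\mathcal A,\mathcal T_{\mathcal A},(-),\preceq)$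 is a triple (resp. pseudo-triple) with a surpassing relation such that for each $a\in\mathcal T_{\mathcal A}$ there is a unique $b\in\mathcal T_{\mathcal A}$ with $0\preceq a+b$, namely $b=(-)a$. Ground system and modules. $\mathcal A=(\mathcal A,\mathcal T,(-),\preceq)$ is a fixed semiring system: a system in which $\mathcal A$ is a semiring (with $0$ and $1$), with tangible set $\mathcal T\subseteq\mathcal A$ acting by multiplication. An $\mathcal A$-systemic module is a pseudo-system $(\mathcal M,\mathcal T_{\mathcal M},(-),\preceq)$ (with scalars $\mathcal T$) such that $\mathcal M$ is an $\mathcal A$-module, $\mathcal T_{\mathcal M}$ spans $\mathcal M$, $\mathcal T\mathcal T_{\mathcal M}\subseteq\mathcal T_{\mathcal M}$, $((-)a)m=(-)(am)$ for $a\in\mathcal A$, $m\in\mathcal M$, and $a_1b_1\preceq a_2b_2$ whenever $a_1\preceq a_2$ in $\mathcal A$ and $b_1\preceq b_2$ in $\mathcal M$. The symbol $\preceq$ is used for all surpassing relations. The free $\mathcal A$-systemic module (free system) on an index set $I$ is the direct sum $\mathcal A^{(I)}$ of copies of $\mathcal A$, with componentwise operations, negation and $\preceq$, and tangible set the union of the copies of $\mathcal T$ in the coordinates. Morphisms. A $\preceq$-morphism $\varphi:\mathcal M\to\mathcal M'$ is a map with $\varphi(0)=0$, $\varphi((-)b)=(-)\varphi(b)$, $\varphi(b_1+b_2)\preceq\varphi(b_1)+\varphi(b_2)$, $\varphi(ab)=a\varphi(b)$ for $a\in\mathcal T$, and $b\preceq b'\Rightarrow\varphi(b)\preceq\varphi(b')$.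 A homomorphism is the same with equality $\varphi(b_1+b_2)=\varphi(b_1)+\varphi(b_2)$. For maps, $f\preceq g$ means $f(b)\preceq g(b)$ for all $b$. $\mathrm{Mor}_\preceq(\mathcal M,\mathcal N)$ is the set of $\preceq$-morphisms $\mathcal M\to\mathcal N$ and $\mathrm{Hom}(\mathcal M,\mathcal N)$ its subset of homomorphisms. Onto and splitting. A map $f:X\to Y$ is $\preceq$-onto if for every $y\in Y$ there is $x\in X$ with $y\preceq f(x)$ (on sets of morphisms, $\preceq$ is the pointwise relation). A $\preceq$-morphism $\pi:\mathcal M\to\mathcal N$ $\preceq$-splits (resp. h-splits) if there is a $\preceq$-morphism (resp. homomorphism) $\nu:\mathcal N\to\mathcal M$ with $1_{\mathcal N}\preceq\pi\nu$. Projectivity. $\mathcal P$ is $(\preceq,h)$-projective if for any $\preceq$-onto homomorphism $h:\mathcal M\to\mathcal M'$ of systemic modules and any $\preceq$-morphism $f:\mathcal P\to\mathcal M'$ there is a $\preceq$-morphism $\tilde f:\mathcal P\to\mathcal M$ with $f\preceq h\tilde f$. $\mathcal P$ is h-projective if for any $\preceq$-onto homomorphism $h:\mathcal M\to\mathcal M'$ and any homomorphism $f:\mathcal P\to\mathcal M'$ there is a homomorphism $\tilde f:\mathcal P\to\mathcal M$ with $f\preceq h\tilde f$.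
   Formalization: It is assumed that for every index set I the direct sum A^(I) is an A-systemic module, as its name ''free A-systemic module'' presupposes; the listed axioms do not imply this, and without it (i) and (ii) need not imply (iii), e.g. when 0 ≼ a for a tangible a. *)

(* Defs.v *)
From HB Require Import structures.
From mathcomp Require Import all_boot ssralg.
From mathcomp Require Import boolp classical_sets functions cardinality.

Set Implicit Arguments.
Unset Strict Implicit.
Unset Printing Implicit Defensive.

Import GRing.Theory.
Local Open Scope classical_set_scope.
Local Open Scope ring_scope.

(* The scalar set [T] is a subset of an ambient type [S]: nothing is required
   of [act a] for [a] outside [T]. *)
Record is_tmodule (S : Type) (T : set S) (V : nmodType) (act : S -> V -> V) :
    Prop := {
  tmod_actD : forall a, T a -> {morph act a : b c / b + c};
  tmod_act0 : forall a, T a -> act a 0 = 0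
}.

Record is_negation_map (S : Type) (T : set S) (V : nmodType)
    (act : S -> V -> V) (neg : V -> V) : Prop := {
  neg_map0 : neg 0 = 0;
  neg_mapD : {morph neg : b c / b + c};
  neg_mapK : involutive neg;
  neg_act : forall a b, T a -> neg (act a b) = act a (neg b)
}.

Definition circ (V : nmodType) (neg : V -> V) (b : V) : V := b + neg b.

Record is_pseudo_triple (S : Type) (T : set S) (V : nmodType)
    (act : S -> V -> V) (TV : set V) (neg : V -> V) : Prop := {
  ptriple_tmodule : is_tmodule T act;
  ptriple_neg : is_negation_map T act neg;
  ptriple_negT : neg @` TV = TV
}.

Record is_triple (S : Type) (T : set S) (V : nmodType)
    (act : S -> V -> V) (TV : set V) (neg : V -> V) : Prop := {
  triple_pseudo : is_pseudo_triple T act TV neg;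
  triple_disj : TV `&` range (circ neg) = set0;
  triple_gen : forall b : V, exists2 s : seq V,
    {subset s <= TV `|` [set 0]} & b = \sum_(x <- s) x
}.

Record is_surpassing (S : Type) (T : set S) (V : nmodType)
    (act : S -> V -> V) (TV : set V) (neg : V -> V) (le : V -> V -> Prop) :
    Prop := {
  surp_refl : forall b, le b b;
  surp_trans : forall b c d, le b c -> le c d -> le b d;
  surp_circ : forall c, le 0 (circ neg c);
  surp_neg : forall b1 b2, le b1 b2 -> le (neg b1) (neg b2);
  surp_add : forall b1 b2 c1 c2, le b1 b2 -> le c1 c2 -> le (b1 + c1) (b2 + c2);
  surp_act : forall a b1 b2, T a -> le b1 b2 -> le (act a b1) (act a b2);
  surp_tangible : forall a b, TV a -> TV b -> le a b -> a = b
}.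

Definition unique_negatives (V : nmodType) (TV : set V) (neg : V -> V)
    (le : V -> V -> Prop) : Prop :=
  forall a, TV a -> unique (fun b => TV b /\ le 0 (a + b)) (neg a).

Record is_pseudo_system (S : Type) (T : set S) (V : nmodType)
    (act : S -> V -> V) (TV : set V) (neg : V -> V) (le : V -> V -> Prop) :
    Prop := {
  psys_triple : is_pseudo_triple T act TV neg;
  psys_surp : is_surpassing T act TV neg le;
  psys_uniq : unique_negatives TV neg le
}.

Record is_system (S : Type) (T : set S) (V : nmodType)
    (act : S -> V -> V) (TV : set V) (neg : V -> V) (le : V -> V -> Prop) :
    Prop := {
  sys_triple : is_triple T act TV neg;
  sys_surp : is_surpassing T act TV neg le;
  sys_uniq : unique_negatives TV neg le
}.

Record semiringSystem := SemiringSystem {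
  ss_sort :> pzSemiRingType;
  ss_tangible : set ss_sort;
  ss_neg : ss_sort -> ss_sort;
  ss_le : ss_sort -> ss_sort -> Prop;
  ss_ax : is_system ss_tangible (fun a b => a * b) ss_tangible ss_neg ss_le
}.

Record moduleData (A : semiringSystem) := ModuleData {
  md_sort :> lSemiModType A;
  tangible : set md_sort;
  neg : md_sort -> md_sort;
  prec : md_sort -> md_sort -> Prop
}.
Arguments tangible {A} M : rename.
Arguments neg {A M} x : rename.
Arguments prec {A M} x y : rename.

Record is_systemic_module (A : semiringSystem) (M : moduleData A) : Prop := {
  sm_psys : is_pseudo_system (@ss_tangible A) (fun a (m : M) => a *: m)
              (tangible M) neg prec;
  sm_span : forall m : M, exists2 s : seq (A * M),
    (forall p, p \in s -> tangible M p.2) & m = \sum_(p <- s) p.1 *: p.2;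
  sm_actT : forall (a : A) (m : M),
    ss_tangible a -> tangible M m -> tangible M (a *: m);
  sm_neg : forall (a : A) (m : M), ss_neg a *: m = neg (a *: m);
  sm_prec : forall (a1 a2 : A) (b1 b2 : M),
    ss_le a1 a2 -> prec b1 b2 -> prec (a1 *: b1) (a2 *: b2)
}.

Record systemicModule (A : semiringSystem) := SystemicModule {
  sm_data :> moduleData A;
  sm_ax : is_systemic_module sm_data
}.

Section DirectSum.
Variables (I : Type) (R : pzSemiRingType).

Definition fin_supp : pred (I -> R) :=
  fun f => `[< finite_set [set i | f i != 0] >].

Lemma fin_supp_closed : addr_closed fin_supp.
Proof.
split=> [|f g /asboolP ff /asboolP fg]; apply/asboolP.
  by apply: (sub_finite_set _ (finite_set0 I)) => i /=; rewrite eqxx.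
apply: (sub_finite_set _ (_ : finite_set ([set i | f i != 0] `|` [set i | g i != 0]))).
  move=> i /= fgi; case: (eqVneq (f i) 0) => [fi0|]; last by left.
  by right; apply: contra fgi => /eqP gi0; rewrite fctE fi0 gi0 addr0.
by rewrite finite_setU.
Qed.

Record dsum := DSum { dsum_val :> I -> R; dsum_supp : fin_supp dsum_val }.
HB.instance Definition _ := [isSub for dsum_val].
HB.instance Definition _ := [Choice of dsum by <:].
HB.instance Definition _ :=
  GRing.SubChoice_isSubNmodule.Build (I -> R) fin_supp dsum fin_supp_closed.

Lemma dsum_mapP (phi : R -> R) (x : dsum) :
  phi 0 = 0 -> fin_supp (phi \o x).
Proof.
move=> phi0; have /asboolP fx := dsum_supp x; apply/asboolP.
by apply: sub_finite_set fx => i /=; apply: contra => /eqP ->; rewrite phi0.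
Qed.

Definition dsum_map (phi : R -> R) (phi0 : phi 0 = 0) (x : dsum) : dsum :=
  DSum (dsum_mapP x phi0).

Definition dsum_scale (a : R) : dsum -> dsum := dsum_map (mulr0 a).

Lemma dsum_ext (x y : dsum) : x =1 y -> x = y.
Proof. by move=> xy; apply/val_inj/funext. Qed.

Lemma dsum_scaleA a b x : dsum_scale a (dsum_scale b x) = dsum_scale (a * b) x.
Proof. by apply: dsum_ext => i /=; rewrite mulrA. Qed.
Lemma dsum_scale0 x : dsum_scale 0 x = 0.
Proof. by apply: dsum_ext => i /=; rewrite mul0r. Qed.
Lemma dsum_scale1 : left_id 1 dsum_scale.
Proof. by move=> x; apply: dsum_ext => i /=; rewrite mul1r. Qed.
Lemma dsum_scaleDr : right_distributive dsum_scale +%R.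
Proof. by move=> a x y; apply: dsum_ext => i /=; rewrite mulrDr. Qed.
Lemma dsum_scaleDl x : {morph dsum_scale^~ x : a b / a + b}.
Proof. by move=> a b; apply: dsum_ext => i /=; rewrite mulrDl. Qed.

HB.instance Definition _ := GRing.Nmodule_isLSemiModule.Build R dsum
  dsum_scaleA dsum_scale0 dsum_scale1 dsum_scaleDr dsum_scaleDl.
End DirectSum.

Lemma ss_neg0 (A : semiringSystem) : ss_neg (0 : A) = 0.
Proof. exact: neg_map0 (ptriple_neg (triple_pseudo (sys_triple (ss_ax A)))). Qed.

(* The tangible elements are the finitely supported families with exactly one
   entry outside of which they vanish, that entry being tangible.
   [is_systemic_module (free_system A I)] is a condition on [A]: if some
   tangible [a] satisfies [ss_le 0 a], then [a] placed in any two coordinates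
   has two distinct quasi-negatives. *)
Definition free_system (A : semiringSystem) (I : Type) : moduleData A :=
  @ModuleData A (dsum I A)
    [set x | exists i, ss_tangible (x i) /\ forall j, j <> i -> x j = 0]
    (dsum_map (@ss_neg0 A))
    (fun x y => forall i, ss_le (x i) (y i)).

Section Morphisms.
Variable A : semiringSystem.

Record precMor (M N : moduleData A) := PrecMor {
  pm_fun :> M -> N;
  pm0 : pm_fun 0 = 0;
  pm_neg : forall b, pm_fun (neg b) = neg (pm_fun b);
  pm_add : forall b1 b2, prec (pm_fun (b1 + b2)) (pm_fun b1 + pm_fun b2);
  pm_act : forall (a : A) b, ss_tangible a -> pm_fun (a *: b) = a *: pm_fun b;
  pm_prec : forall b b', prec b b' -> prec (pm_fun b) (pm_fun b')
}.

Record sysHom (M N : moduleData A) := SysHom {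
  hom_fun :> M -> N;
  hom0 : hom_fun 0 = 0;
  hom_neg : forall b, hom_fun (neg b) = neg (hom_fun b);
  hom_add : forall b1 b2, hom_fun (b1 + b2) = hom_fun b1 + hom_fun b2;
  hom_act : forall (a : A) b, ss_tangible a -> hom_fun (a *: b) = a *: hom_fun b;
  hom_prec : forall b b', prec b b' -> prec (hom_fun b) (hom_fun b')
}.

Definition map_prec (X : Type) (N : moduleData A) (f g : X -> N) : Prop :=
  forall b, prec (f b) (g b).

Definition prec_onto (X Y : Type) (le : Y -> Y -> Prop) (f : X -> Y) : Prop :=
  forall y, exists x, le y (f x).

(* The section is a morphism, so splitting only depends on [pi] as a map. *)
Definition prec_splits (M N : moduleData A) (pi : M -> N) : Prop :=
  exists nu : precMor N M, map_prec id (pi \o nu).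

Definition h_splits (M N : moduleData A) (pi : M -> N) : Prop :=
  exists nu : sysHom N M, map_prec id (pi \o nu).

Definition prec_h_projective (P : moduleData A) : Prop :=
  forall (M M' : systemicModule A) (h : sysHom M M'), prec_onto prec h ->
  forall f : precMor P M', exists g : precMor P M, map_prec f (h \o g).

Definition h_projective (P : moduleData A) : Prop :=
  forall (M M' : systemicModule A) (h : sysHom M M'), prec_onto prec h ->
  forall f : sysHom P M', exists g : sysHom P M, map_prec f (h \o g).

Definition Mor_post (P M M' : moduleData A) (h : sysHom M M') (g : precMor P M) :
  precMor P M'.
Proof.
exists (h \o g) => [|b|b1 b2|a b aT|b b' bb'] /=.
- by rewrite pm0 hom0.
- by rewrite pm_neg hom_neg.
- by rewrite -hom_add; apply/hom_prec/pm_add.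
- by rewrite pm_act// hom_act.
- exact/hom_prec/pm_prec.
Defined.

Definition Hom_post (P M M' : moduleData A) (h : sysHom M M') (g : sysHom P M) :
  sysHom P M'.
Proof.
exists (h \o g) => [|b|b1 b2|a b aT|b b' bb'] /=.
- by rewrite !hom0.
- by rewrite !hom_neg.
- by rewrite !hom_add.
- by rewrite !hom_act.
- exact/hom_prec/hom_prec.
Defined.

(* Preorders on the sets of morphisms, for use with [prec_onto]. *)
Definition precMor_le (M N : moduleData A) (f g : precMor M N) : Prop :=
  map_prec f g.
Definition hom_le (M N : moduleData A) (f g : sysHom M N) : Prop := map_prec f g.
End Morphisms.

(* Main.v *)
Require Import Defs.
From HB Require Import structures.
From mathcomp Require Import all_boot ssralg.
From mathcomp Require Import boolp classical_sets functions cardinality.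
From mathcomp Require Import fsbigop.

(** Everything rests on one fact: the free system on [I] lifts any
    [prec]-morphism [f] into [M'] along any [prec]-onto homomorphism [h] from
    [M] to [M'], and the lift can be taken to be a homomorphism
    ([free_lifting]). For each basis vector [e_i] choose [m_i] in [M] with
    [f e_i] below [h m_i], and extend linearly. Every scalar is a sum of
    tangible scalars and zeros, so a [prec]-morphism, which is only compatible
    with tangible scalars, still sends a combination of the [e_i] below the same
    combination of the [f e_i] ([precMor_lincomb]); the latter is below the
    combination of the [h m_i], which is the image under [h] of the extension.

    If [P] is projective, lifting the identity of [P] along an onto homomorphism
    splits it. The linear extension of the identity of [P] is an onto
    homomorphism from the free system on [P], so if all onto homomorphisms to [P]
    split, then one from a free system does. If [pi], from a free system to [P],
    has section [nu], then lifting [f \o pi] to the free system and composing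
    with [nu] lifts [f]; as the first lift is a homomorphism, the composite is a
    [prec]-morphism or a homomorphism according to what [nu] is, and so both
    versions follow from the same lemma. That composition with [h] is onto on
    sets of morphisms is projectivity itself. *)

Set Implicit Arguments.
Unset Strict Implicit.
Unset Printing Implicit Defensive.

Import GRing.Theory.
Local Open Scope classical_set_scope.
Local Open Scope ring_scope.

(** * The surpassing relation of a systemic module *)

Section SystemicModule.
Variables (A : semiringSystem) (M : systemicModule A).

Let surpM := psys_surp (sm_psys (sm_ax M)).

Lemma prec_refl (b : M) : prec b b.
Proof. exact: surp_refl surpM b. Qed.

Lemma prec_trans (c b d : M) : prec b c -> prec c d -> prec b d.
Proof. exact: surp_trans surpM b c d. Qed.

Lemma prec_add (b1 b2 c1 c2 : M) :
  prec b1 b2 -> prec c1 c2 -> prec (b1 + c1) (b2 + c2).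
Proof. exact: surp_add surpM b1 b2 c1 c2. Qed.

Lemma prec_sum (J : Type) (s : seq J) (F G : J -> M) :
  (forall j, prec (F j) (G j)) ->
  prec (\sum_(j <- s) F j) (\sum_(j <- s) G j).
Proof.
move=> FG; elim: s => [|j s ih]; first by rewrite !big_nil; exact: prec_refl.
by rewrite !big_cons; exact: prec_add.
Qed.

Lemma neg_sum (J : Type) (s : seq J) (F : J -> M) :
  neg (\sum_(j <- s) F j) = \sum_(j <- s) neg (F j).
Proof.
have negM := ptriple_neg (psys_triple (sm_psys (sm_ax M))).
exact: (big_morph _ (neg_mapD negM) (neg_map0 negM)).
Qed.

End SystemicModule.

Lemma ss_le_refl (A : semiringSystem) (a : A) : ss_le a a.
Proof. exact: surp_refl (sys_surp (ss_ax A)) a. Qed.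

(** * Morphisms and arbitrary scalars *)

Section Morphisms.
Variable A : semiringSystem.

(** The tangible scalars generate the additive monoid of [A], which is what
    allows compatibility with them to be extended to all scalars. *)
Lemma tangible_gen (a : A) :
  exists2 s : seq A, (forall t, t \in s -> ss_tangible t \/ t = 0) &
                     a = \sum_(t <- s) t.
Proof.
have [s sT ->] := triple_gen (sys_triple (ss_ax A)) a.
by exists s => // t /sT; rewrite inE.
Qed.

Lemma precMor_sum (M : moduleData A) (N : systemicModule A) (f : precMor M N)
    (J : Type) (s : seq J) (F : J -> M) :
  prec (f (\sum_(j <- s) F j)) (\sum_(j <- s) f (F j)).
Proof.
elim: s => [|j s ih]; first by rewrite !big_nil pm0; exact: prec_refl.
rewrite !big_cons; apply: prec_trans (pm_add f _ _) _.
exact: prec_add (prec_refl _) ih.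
Qed.

Lemma precMor_scale (M : moduleData A) (N : systemicModule A) (f : precMor M N)
    (a : A) (b : M) :
  prec (f (a *: b)) (a *: f b).
Proof.
have [s sT ->] := tangible_gen a.
rewrite !scaler_suml; apply: prec_trans (precMor_sum _ _ _) _.
rewrite [X in prec X _](_ : _ = \sum_(t <- s) t *: f b); first exact: prec_refl.
apply: eq_big_seq => t /sT[tT|->]; first by rewrite pm_act.
by rewrite !scale0r pm0.
Qed.

Lemma sysHom_sum (M N : moduleData A) (h : sysHom M N)
    (J : Type) (s : seq J) (F : J -> M) :
  h (\sum_(j <- s) F j) = \sum_(j <- s) h (F j).
Proof. exact: (big_morph _ (hom_add h) (hom0 h)). Qed.

Lemma sysHom_scale (M N : moduleData A) (h : sysHom M N) (a : A) (b : M) :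
  h (a *: b) = a *: h b.
Proof.
have [s sT ->] := tangible_gen a.
rewrite !scaler_suml sysHom_sum; apply: eq_big_seq => t /sT[tT|->].
  by rewrite hom_act.
by rewrite !scale0r hom0.
Qed.

Definition sysHom_precMor (M : moduleData A) (N : systemicModule A)
  (h : sysHom M N) : precMor M N.
Proof.
exists h => [|b|b1 b2|a b aT|b b' bb'].
- exact: hom0.
- exact: hom_neg.
- by rewrite hom_add; exact: prec_refl.
- exact: hom_act.
- exact: hom_prec.
Defined.

Definition Mor_pre (M M' N : moduleData A) (f : precMor M' N)
  (h : sysHom M M') : precMor M N.
Proof.
exists (f \o h) => [|b|b1 b2|a b aT|b b' bb'] /=.
- by rewrite hom0 pm0.
- by rewrite hom_neg pm_neg.
- by rewrite hom_add; exact: pm_add.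
- by rewrite hom_act// pm_act.
- exact/pm_prec/hom_prec.
Defined.

Definition id_sysHom (M : moduleData A) : sysHom M M.
Proof. by exists id. Defined.

End Morphisms.

(** * Linear combinations and free systems *)

Section FreeSystem.
Variables (A : semiringSystem) (I : choiceType).
Implicit Types x y : dsum I A.

Lemma dsum_support2 x y : exists2 s : seq I, uniq s &
  forall i, i \notin s -> x i = 0 /\ y i = 0.
Proof.
have /asboolP/finite_seqP[s1 s1E] := dsum_supp x.
have /asboolP/finite_seqP[s2 s2E] := dsum_supp y.
exists (undup (s1 ++ s2)); first exact: undup_uniq.
move=> i; rewrite mem_undup mem_cat negb_or => /andP[is1 is2].
split; apply/eqP; apply: contraT => nz.
  suff : [set` s1] i by rewrite /= (negPf is1).
  by rewrite -s1E.
suff : [set` s2] i by rewrite /= (negPf is2).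
by rewrite -s2E.
Qed.

Definition lincomb (M : lSemiModType A) (m : I -> M) x : M :=
  \sum_(i \in [set: I]) x i *: m i.

(** Lets several combinations be computed over one index sequence that contains
    all the supports involved. *)
Lemma lincombE (M : lSemiModType A) (m : I -> M) x (s : seq I) :
  uniq s -> (forall i, i \notin s -> x i = 0) ->
  lincomb m x = \sum_(i <- s) x i *: m i.
Proof.
move=> us sx; rewrite /lincomb (fsbigE s)//; last first.
  by move=> i _ /sx ->; rewrite scale0r.
by apply: eq_bigl => i; rewrite in_setT.
Qed.

Lemma basis_supp (i : I) : fin_supp (fun j : I => (j == i)%:R : A).
Proof.
apply/asboolP; apply: (sub_finite_set _ (finite_set1 i)) => j /=.
by case: (eqVneq j i) => //= _; rewrite eqxx.
Qed.

Definition basis (i : I) : dsum I A := DSum (basis_supp i).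

Lemma lincomb_basis (M : lSemiModType A) (m : I -> M) (i : I) :
  lincomb m (basis i) = m i.
Proof.
rewrite (@lincombE _ _ _ [:: i])//= => [|j]; last by rewrite inE => /negPf->.
by rewrite big_seq1 eqxx scale1r.
Qed.

Lemma lincomb_of_basis x : lincomb basis x = x.
Proof.
have [s us sx] := dsum_support2 x x.
rewrite (lincombE basis us); last by move=> i /sx[].
apply: dsum_ext => j.
have -> : (\sum_(i <- s) x i *: basis i) j = \sum_(i <- s) x i * (j == i)%:R.
  exact: (big_morph (fun z : dsum I A => z j)).
have [js|/[dup] js /sx[-> _]] := boolP (j \in s).
  rewrite (bigD1_seq j)//= eqxx mulr1 big1 ?addr0// => i.
  by rewrite eq_sym => /negPf->; rewrite mulr0.
rewrite big_seq big1// => i is_; case: eqVneq => [ji|]; last by rewrite mulr0.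
by rewrite ji is_ in js.
Qed.

Lemma prec_lincomb (M : systemicModule A) (m n : I -> M) x y :
  (forall i, prec (m i) (n i)) -> (forall i, ss_le (x i) (y i)) ->
  prec (lincomb m x) (lincomb n y).
Proof.
move=> mn xy; have [s us sxy] := dsum_support2 x y.
rewrite (lincombE m us) => [|i /sxy[]//].
rewrite (lincombE n us) => [|i /sxy[]//].
by apply: prec_sum => i; exact: (sm_prec (sm_ax M)).
Qed.

Lemma precMor_lincomb (M : moduleData A) (N : systemicModule A)
    (f : precMor M N) (m : I -> M) x :
  prec (f (lincomb m x)) (lincomb (f \o m) x).
Proof.
have [s us sx] := dsum_support2 x x.
rewrite !(lincombE _ us); [|by move=> i /sx[]..].
apply: prec_trans (precMor_sum _ _ _) _.
by apply: prec_sum => i; exact: precMor_scale.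
Qed.

Lemma sysHom_lincomb (M N : moduleData A) (h : sysHom M N) (m : I -> M) x :
  h (lincomb m x) = lincomb (h \o m) x.
Proof.
have [s us sx] := dsum_support2 x x.
rewrite !(lincombE _ us); [|by move=> i /sx[]..].
by rewrite sysHom_sum; apply: eq_bigr => i _; exact: sysHom_scale.
Qed.

(** The universal property of the free system. Linear extension respects [neg]
    and [prec] because scalar multiplication on [M] is compatible with negation
    and with [prec] in both arguments. *)
Definition free_extension (M : systemicModule A) (m : I -> M) :
  sysHom (free_system A I) M.
Proof.
exists (lincomb m) => [|x|x y|a x aT|x y xy].
- by rewrite (@lincombE _ m 0 [::])// big_nil.
- have [s us sx] := dsum_support2 x x.
  rewrite !(lincombE m us) => [|i /sx[]//|i /sx[/= -> _]]; last exact: ss_neg0.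
  by rewrite neg_sum; apply: eq_bigr => i _; exact: sm_neg (sm_ax M) _ _.
- have [s us sxy] := dsum_support2 x y.
  rewrite !(lincombE m us) => [|i /sxy[]//|i /sxy[]//|i /sxy[xi yi]].
    by rewrite -big_split; apply: eq_bigr => i _; exact: scalerDl.
  by rewrite /= fctE xi yi addr0.
- have [s us sx] := dsum_support2 x x.
  rewrite !(lincombE m us) => [|i /sx[]//|i /sx[/= -> _]]; last exact: mulr0.
  by rewrite scaler_sumr; apply: eq_bigr => i _; rewrite scalerA.
- by apply: prec_lincomb => // i; exact: prec_refl.
Defined.

(** The lift is determined by choosing, for each basis vector, an element of [M]
    whose image surpasses [f] there. It is a homomorphism even though [f] is
    only a [prec]-morphism. *)
Lemma free_lifting (M M' : systemicModule A) (h : sysHom M M')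
    (f : precMor (free_system A I) M') :
  prec_onto prec h ->
  exists g : sysHom (free_system A I) M, map_prec f (h \o g).
Proof.
move=> /(_ (f (basis _)))-/choice[m fm].
exists (free_extension m) => x /=.
rewrite -{1}[x]lincomb_of_basis sysHom_lincomb.
apply: prec_trans (precMor_lincomb f _ x) _.
by apply: prec_lincomb => // i; exact: ss_le_refl.
Qed.

End FreeSystem.

(** Every element of [P] is the image of its own basis vector. *)
Lemma free_cover (A : semiringSystem) (P : systemicModule A) :
  prec_onto prec (free_extension (@id P)).
Proof.
move=> b; exists (basis A b).
by rewrite /= lincomb_basis; exact: prec_refl.
Qed.

(** As [f] is monotone, it is below [f \o pi \o nu], and [g] lifts [f \o pi].
    Since [nu] is arbitrary and [g] is a homomorphism, [g \o nu] is a morphism of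
    the same kind as [nu], whether a [prec]-morphism or a homomorphism. *)
Lemma lifting_over_free_cover (A : semiringSystem) (P M M' : systemicModule A)
    (I : Type) (pi : sysHom (free_system A I) P) (h : sysHom M M')
    (f : precMor P M') :
  prec_onto prec h ->
  exists g : sysHom (free_system A I) M,
    forall nu : P -> free_system A I, map_prec id (pi \o nu) ->
      map_prec f (h \o (g \o nu)).
Proof.
elim/Pchoice: I => I in pi *.
move=> /(free_lifting (Mor_pre f pi))[g fg]; exists g => nu idnu b /=.
exact: prec_trans (pm_prec f (idnu b)) (fg (nu b)).
Qed.

Theorem propositionB (A : semiringSystem)
    (freeA : forall I : Type, is_systemic_module (free_system A I))
    (P : systemicModule A) :
  [<-> prec_h_projective P;
       forall (M : systemicModule A) (pi : sysHom M P),
         prec_onto prec pi -> prec_splits pi;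
       exists (I : Type) (pi : sysHom (free_system A I) P),
         prec_onto prec pi /\ prec_splits pi;
       forall (M M' : systemicModule A) (h : sysHom M M'), prec_onto prec h ->
         prec_onto (@precMor_le A P M') (@Mor_post A P M M' h)]
  /\
  [<-> h_projective P;
       forall (M : systemicModule A) (pi : sysHom M P),
         prec_onto prec pi -> h_splits pi;
       exists (I : Type) (pi : sysHom (free_system A I) P),
         prec_onto prec pi /\ h_splits pi;
       forall (M M' : systemicModule A) (h : sysHom M M'), prec_onto prec h ->
         prec_onto (@hom_le A P M') (@Hom_post A P M M' h)].
Proof.
split; tfae.
- by move=> projP M pi pi_onto; exact: projP (sysHom_precMor (id_sysHom P)).
- move=> splitP; exists P, (free_extension (@id P)).
  split; first exact: free_cover.
  exact: (splitP (SystemicModule (freeA P)) _ (@free_cover _ P)).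
- move=> [I [pi [_ [nu idnu]]]] M M' h h_onto f.
  have [g fg] := lifting_over_free_cover pi f h_onto.
  by exists (Mor_post g nu); exact: fg.
- by move=> post M M' h h_onto f; have [g fg] := post M M' h h_onto f; exists g.
- by move=> projP M pi pi_onto; exact: projP (id_sysHom P).
- move=> splitP; exists P, (free_extension (@id P)).
  split; first exact: free_cover.
  exact: (splitP (SystemicModule (freeA P)) _ (@free_cover _ P)).
- move=> [I [pi [_ [nu idnu]]]] M M' h h_onto f.
  have [g fg] := lifting_over_free_cover pi (sysHom_precMor f) h_onto.
  by exists (Hom_post g nu); exact: fg.
- by move=> post M M' h h_onto f; have [g fg] := post M M' h h_onto f; exists g.
Qed.
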